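(* Let $\mathbb{L}$ be a finite lattice, and let $S$ be the set of all admissible operation sequences on $\mathbb{L}$. Then $S$ is at most countable, and the partially ordered set $(S,\sqsubseteq)$ has no infinite descending chains and no infinite antichains.
   Context: $\mathbb{N}$ denotes the set of positive integers. Operation sequences. An operation sequence on $\mathbb{L}$ is a sequence $(f_i)_{i\in\mathbb{N}}$ with $f_i:\mathbb{L}^i\to\mathbb{L}$ for each $i\in\mathbb{N}$. It is admissible if for all $n,k\in\mathbb{N}$ with $k\le n$ and all elements $\alpha_1,\alpha_2,\ldots$ of $\mathbb{L}$: - (HC1) $f_n(\alpha_1,\ldots,\alpha_n)\le\alpha_k$; - (HC2) $f_n$ is monotonous, i.e. preserves $\le$; - (HC3) $f_{n+1}(\alpha_1,\ldots,\alpha_{n+1})\le f_n(\alpha_2,\ldots,\alpha_{n+1})$; - (HC4) $f_n$ is symmetric, i.e. $f_n(\alpha_1,\ldots,\alpha_n)=f_n(\alpha_{\pi(1)},\ldots,\alpha_{\pi(n)})$ for all $\pi\in S_n$; - (HC7) $f_n$ is join distributive, i.e. for all $i\in\{1,\ldots,n\}$ and all families $\langle\beta_j : j\in J\rangle$ in $\mathbb{L}$, $f_n(\alpha_1,\ldots,\alpha_{i-1},\bigvee_{j\in J}\beta_j,\alpha_{i+1},\ldots,\alpha_n)=\bigvee_{j\in J}f_n(\alpha_1,\ldots,\alpha_{i-1},\beta_j,\alpha_{i+1},\ldots,\alpha_n)$; - (HC8) $f_k(\alpha_1,\ldots,\alpha_{k-1},f_{n-k+1}(\alpha_k,\ldots,\alpha_n))\le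 f_n(\alpha_1,\ldots,\alpha_n)$. Order. For operation sequences, $(f_i)_{i\in\mathbb{N}}\sqsubseteq(g_i)_{i\in\mathbb{N}}$ means that for all $i\in\mathbb{N}$ and all $\alpha_1,\ldots,\alpha_i\in\mathbb{L}$ we have $f_i(\alpha_1,\ldots,\alpha_i)\le g_i(\alpha_1,\ldots,\alpha_i)$. *)

(* Defs.v *)
From mathcomp Require Import all_boot all_order all_fingroup.
From mathcomp Require Import boolp classical_sets functions cardinality.

Set Implicit Arguments.
Unset Strict Implicit.
Unset Printing Implicit Defensive.

Import Order.TTheory.

Local Open Scope classical_set_scope.
Local Open Scope order_scope.

(* Arities are positive, so the component [f n] of [f : opseq L] is the
   operation f_{n+1} of arity n+1, and the variables alpha_1, ..., alpha_{n+1}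
   are numbered from 0 to n. *)
Definition opseq (L : Type) : Type := forall n : nat, (L ^ n.+1)%type -> L.

Section Admissible.
Context {d : Order.disp_t} {L : finTBLatticeType d}.
Implicit Types (f g : opseq L).

(* J is an arbitrary, possibly empty or infinite, index type; the join of a
   family is the join of its (finite) range. *)
Definition family_join (J : Type) (b : J -> L) : L :=
  \join_(x : L | `[< range b x >]) x.

Definition subst_at n (a : (L ^ n.+1)%type) (i : 'I_n.+1) (b : L) :
    (L ^ n.+1)%type :=
  [ffun j => if j == i then b else a j].

Definition HC1 f : Prop :=
  forall n (a : (L ^ n.+1)%type) (k : 'I_n.+1), f n a <= a k.

Definition HC2 f : Prop :=
  forall n (a b : (L ^ n.+1)%type), (forall i, a i <= b i) -> f n a <= f n b.

Definition HC3 f : Prop :=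
  forall n (a : (L ^ n.+2)%type),
    f n.+1 a <= f n [ffun i : 'I_n.+1 => a (lift ord0 i)].

Definition HC4 f : Prop :=
  forall n (a : (L ^ n.+1)%type) (p : 'S_n.+1),
    f n a = f n [ffun i => a (p i)].

Definition HC7 f : Prop :=
  forall n (a : (L ^ n.+1)%type) (i : 'I_n.+1) (J : Type) (b : J -> L),
    f n (subst_at a i (family_join b)) =
    family_join (fun j => f n (subst_at a i (b j))).

(* k and n are here the k - 1 and n - 1 of the usual numbering, so that
   f_{n-k+1} is the component of index n - k. *)
Definition HC8 f : Prop :=
  forall (n k : nat) (a : nat -> L), (k <= n)%N ->
    f k [ffun i : 'I_k.+1 =>
           if (i < k)%N then a i
           else f (n - k)%N [ffun j : 'I_(n - k).+1 => a (k + j)%N]]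
    <= f n [ffun i : 'I_n.+1 => a i].

Definition admissible f : Prop :=
  [/\ HC1 f, HC2 f & HC3 f] /\ [/\ HC4 f, HC7 f & HC8 f].

Definition opseq_le f g : Prop :=
  forall n (a : (L ^ n.+1)%type), f n a <= g n a.

Lemma opseq_le_refl f : opseq_le f f.
Proof. by move=> n a. Qed.

Lemma opseq_le_trans f g h : opseq_le f g -> opseq_le g h -> opseq_le f h.
Proof. by move=> fg gh n a; apply: le_trans (fg n a) (gh n a). Qed.

Lemma opseq_le_anti f g : opseq_le f g -> opseq_le g f -> f = g.
Proof.
move=> fg gf; apply: functional_extensionality_dep => n; apply/funext => a.
by apply/le_anti; rewrite fg gf.
Qed.

End Admissible.

Definition admissible_opseqs {d : Order.disp_t} (L : finTBLatticeType d) :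
  set (opseq L) := [set f | admissible f].
Arguments admissible_opseqs {d} L.

Definition infinite_descending_chain (T : Type) (le : T -> T -> Prop)
    (A : set T) (u : nat -> T) : Prop :=
  (forall n, A (u n)) /\ (forall n, le (u n.+1) (u n) /\ u n.+1 <> u n).

Definition infinite_antichain (T : Type) (le : T -> T -> Prop)
    (A C : set T) : Prop :=
  [/\ C `<=` A, infinite_set C &
      forall x y, C x -> C y -> x <> y -> ~ le x y /\ ~ le y x].

(* Main.v *)
Require Import Defs.
From mathcomp Require Import all_boot all_order all_fingroup.
From mathcomp Require Import boolp classical_sets functions cardinality.

(** By symmetry (HC4) and monotonicity under adding an argument (HC3), an
    admissible sequence is a map from words over [L] to [L] that depends only
    on the number of occurrences of each letter and decreases when a letter is
    added: an antitone map from a power of the natural numbers to the finite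
    poset [L].  Antitone maps from [nat ^ m] to a finite poset, ordered
    pointwise, form a countable well-quasi-order; for a two-element poset the
    absence of infinite antichains is the theorem that antichains of monomial
    ideals are finite.  In a well-quasi-order every sequence [u] has a pair
    [i < j] of indices with [u i] below [u j], which excludes infinite
    descending chains and infinite antichains.

    The proof is by induction on the number of letters.  Currying, an antitone
    map on [nat ^ m.+1] is a nonincreasing sequence of antitone maps on
    [nat ^ m], so it suffices that nonincreasing sequences in a countable
    well-quasi-order [Q] form a countable well-quasi-order.  They are
    eventually constant ([nonincr_stationary]), hence determined by finitely
    many elements of [Q], which gives countability ([coded_nonincr]).

    The well-quasi-order property ([wqo_nonincr]) is proved by induction on
    [Q], from the sets of elements not above a given [q] to [Q] itself
    ([wqo_residual_ind]).  In a sequence of nonincreasing sequences without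
    increasing pair, pass to a subsequence along which the eventual values
    increase, and let [u] be its first member.  Each later member [v] has an
    eventual value above that of [u], so that [u] can exceed [v] only at one of
    the finitely many positions [k] before [u] becomes constant.  Since [v] is
    nonincreasing, all of [v] from [k] on avoids the elements above [u k], and
    there the induction hypothesis applies. *)

Set Implicit Arguments.
Unset Strict Implicit.
Unset Printing Implicit Defensive.

Import Order.TTheory.

Local Open Scope order_scope.
Local Open Scope classical_set_scope.

(** * Well-quasi-orders *)

Definition wqo (T : Type) (R : T -> T -> Prop) (A : set T) : Prop :=
  forall u : nat -> T, (forall n, A (u n)) ->
    exists i j, (i < j)%N /\ R (u i) (u j).

Definition preorder (T : Type) (R : T -> T -> Prop) : Prop :=
  (forall x, R x x) /\ (forall y x z, R x y -> R y z -> R x z).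

Lemma wqo_pullback (T T' : Type) (f : T -> T') (R : T -> T -> Prop)
    (R' : T' -> T' -> Prop) (A : set T) (B : set T') :
    (forall x, A x -> B (f x)) ->
    (forall x y, A x -> A y -> R' (f x) (f y) -> R x y) ->
  wqo R' B -> wqo R A.
Proof.
move=> AB RR' wB u Au.
have [i [j [ij Rij]]] := wB (f \o u) (fun n => AB _ (Au n)).
by exists i, j; split=> //; apply: RR'.
Qed.

Lemma wqo_finite (I : finType) (R : I -> I -> Prop) (A : set I) :
  (forall x, R x x) -> wqo R A.
Proof.
move=> Rxx u _; apply: contrapT => bad.
have inj : injective (fun k : 'I_#|I|.+1 => u k).
  move=> i j uij; apply/val_inj; case: (ltngtP i j) => // ij.
    by exfalso; apply: bad; exists i, j; rewrite uij.
  by exfalso; apply: bad; exists j, i; rewrite uij.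
by have := leq_card _ inj; rewrite card_ord ltnn.
Qed.

(** All but finitely many indices have a later index with a larger value: an
    infinity of exceptions would be a sequence without increasing pair. *)
Lemma wqo_increasing_subseq (T : Type) (R : T -> T -> Prop) (A : set T) u :
    (forall y x z, R x y -> R y z -> R x z) -> wqo R A ->
    (forall n, A (u n)) ->
  exists p : nat -> nat, forall i j, (i < j)%N ->
    (p i < p j)%N /\ R (u (p i)) (u (p j)).
Proof.
move=> Rtr wA Au.
have [M HM] : exists M, forall i, (M <= i)%N ->
    exists j, (i < j)%N /\ R (u i) (u j).
  apply: contrapT => noM.
  have /choice[t tP] : forall M, exists i, (M <= i)%N /\
      forall j, (i < j)%N -> ~ R (u i) (u j).
    move=> M; apply: contrapT => noi; apply: noM; exists M => i Mi.
    apply: contrapT => noj; apply: noi; exists i; split=> // j ij Rij.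
    by apply: noj; exists j.
  pose p k := iter k (fun i => t i.+1) (t 0).
  have pincr : {homo p : i j / (i < j)%N >-> (i < j)%N}.
    by apply: homo_ltn => [y x z|i]; [exact: ltn_trans | have [] := tP (p i).+1].
  have pP k : forall j, (p k < j)%N -> ~ R (u (p k)) (u j).
    by case: k => [|k]; [have [] := tP 0 | have [] := tP (p k).+1].
  have [i [j [ij]]] := wA (u \o p) (fun n => Au _).
  exact/pP/pincr.
have /choice[s sP] : forall i, exists j, (M <= i)%N ->
    (i < j)%N /\ R (u i) (u j).
  move=> i; case: (boolP (M <= i)%N) => [/HM[j jP]|_]; first by exists j.
  by exists 0.
pose p k := iter k s M.
have Mp k : (M <= p k)%N.
  by elim: k => //= k IH; have [/ltnW lt_s _] := sP _ IH; exact: leq_trans lt_s.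
exists p.
apply: (@homo_ltn _ p (fun a b => (a < b)%N /\ R (u a) (u b))).
  move=> b a c [ab Rab] [bc Rbc].
  by split; [exact: ltn_trans bc | exact: Rtr Rbc].
by move=> i; have := sP _ (Mp i).
Qed.

Lemma wqo_conj (T : Type) (R S : T -> T -> Prop) (A : set T) :
    (forall y x z, R x y -> R y z -> R x z) -> wqo R A -> wqo S A ->
  wqo (fun x y => R x y /\ S x y) A.
Proof.
move=> Rtr wR wS u Au.
have [p pP] := wqo_increasing_subseq Rtr wR Au.
have [i [j [ij Sij]]] := wS (u \o p) (fun n => Au _).
by have [pij Rij] := pP _ _ ij; exists (p i), (p j).
Qed.

Lemma wqo_union (T : Type) (R : T -> T -> Prop) (A B : set T) :
  wqo R A -> wqo R B -> wqo R (A `|` B).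
Proof.
move=> wA wB u uAB.
have [[M uB]|noM] := pselect (exists M, forall i, (M <= i)%N -> B (u i)).
  have [i [j [ij Rij]]] := wB (fun i => u (M + i)%N) (fun i => uB _ (leq_addr _ _)).
  by exists (M + i)%N, (M + j)%N; rewrite ltn_add2l.
have /choice[t tP] : forall M, exists i, (M <= i)%N /\ A (u i).
  move=> M; apply: contrapT => noi; apply: noM; exists M => i Mi.
  by case: (uAB i) => // Ai; exfalso; apply: noi; exists i.
pose p k := iter k (fun i => t i.+1) (t 0).
have pincr : {homo p : i j / (i < j)%N >-> (i < j)%N}.
  by apply: homo_ltn => [y x z|i]; [exact: ltn_trans | have [] := tP (p i).+1].
have pA k : A (u (p k)).
  by case: k => [|k]; [have [] := tP 0 | have [] := tP (p k).+1].
have [i [j [ij Rij]]] := wA (u \o p) pA.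
by exists (p i), (p j); split=> //; exact: pincr.
Qed.

(** Noetherian induction: repeatedly removing the elements above a chosen
    element must stop, since the chosen elements would otherwise form a
    sequence without increasing pair. *)
Lemma wqo_residual_ind (T : Type) (R : T -> T -> Prop) (P : set T -> Prop) :
    (forall A, (forall q, A q -> P (A `&` [set x | ~ R q x])) -> P A) ->
  forall A, wqo R A -> P A.
Proof.
move=> indP A0 wA0; apply: contrapT => nPA0.
have step A : ~ P A -> exists q, A q /\ ~ P (A `&` [set x | ~ R q x]).
  move=> nPA; apply: contrapT => noq; apply: nPA; apply: indP => q Aq.
  by apply: contrapT => nPq; apply: noq; exists q.
have [q0 _] := step _ nPA0.
have /choice[q qP] : forall A, exists q, ~ P A ->
    A q /\ ~ P (A `&` [set x | ~ R q x]).
  move=> A; case: (pselect (P A)) => [PA|/step[q qP]]; last by exists q.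
  by exists q0.
pose B n := iter n (fun A => A `&` [set x | ~ R (q A) x]) A0.
have nPB n : ~ P (B n) by elim: n => //= n IH; have [] := qP _ IH.
have Bsub : {homo B : i j / (i <= j)%N >-> j `<=` i}.
  apply: (@homo_leq _ B (fun C D => D `<=` C)) => [C|C D E DC CE|n] //.
    exact: subset_trans DC.
  by move=> x [].
have Bq n : B n (q (B n)) by have [] := qP _ (nPB n).
have [i [j [ij]]] := wA0 (fun n => q (B n)) (fun n => Bsub _ _ (leq0n n) _ (Bq n)).
by have [] := Bsub _ _ ij _ (Bq j).
Qed.

(** * Nonincreasing sequences in a well-quasi-order *)

Definition nonincr (T : Type) (R : T -> T -> Prop) (A : set T) :
    set (nat -> T) :=
  [set u | (forall n, A (u n)) /\ (forall n, R (u n.+1) (u n))].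

Definition pointwise (T : Type) (R : T -> T -> Prop) (u v : nat -> T) : Prop :=
  forall n, R (u n) (v n).

(** Countability up to the equivalence that a preorder [R] induces; for an
    antisymmetric [R] this is countability of [A]. *)
Definition coded (T : Type) (R : T -> T -> Prop) (A : set T) : Prop :=
  exists c : T -> nat, forall x y, A x -> A y -> c x = c y -> R x y.

Lemma coded_pullback (T T' : Type) (f : T -> T') (R : T -> T -> Prop)
    (R' : T' -> T' -> Prop) (A : set T) (B : set T') :
    (forall x, A x -> B (f x)) ->
    (forall x y, A x -> A y -> R' (f x) (f y) -> R x y) ->
  coded R' B -> coded R A.
Proof.
move=> AB RR' [c cP]; exists (c \o f) => x y Ax Ay cxy.
by apply: RR' => //; apply: cP => //; apply: AB.
Qed.

Section Nonincreasing.
Context {T : Type} {R : T -> T -> Prop}.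
Hypothesis preR : preorder R.
Implicit Types (A : set T) (u v : nat -> T).

Lemma nonincrP A u i j : nonincr R A u -> (i <= j)%N -> R (u j) (u i).
Proof.
case: preR => Rxx Rtr [_ uR]; move: i j.
apply: (@homo_leq _ u (fun x y => R y x)) => // y x z yx zy.
exact: Rtr zy yx.
Qed.

(** Otherwise some subsequence [u (p i)] strictly decreases at each step, and
    an increasing pair in it would bound one of these steps. *)
Lemma nonincr_stationary A u : wqo R A -> nonincr R A u ->
  exists N, forall k, (N <= k)%N -> R (u N) (u k).
Proof.
have [Rxx Rtr] := preR => wA uA; apply: contrapT => noN.
have /choice[t tP] : forall N, exists k, (N <= k)%N /\ ~ R (u N) (u k).
  move=> N; apply: contrapT => nok; apply: noN; exists N => k Nk.
  by apply: contrapT => nR; apply: nok; exists k.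
pose p i := iter i t 0.
have pincr : {homo p : i j / (i <= j)%N >-> (i <= j)%N}.
  by apply: homo_leq => [//|y x z|i]; [exact: leq_trans | have [] := tP (p i)].
have [i [j [ij Rij]]] := wA (u \o p) (fun n => uA.1 _).
have [_] := tP (p i); apply.
exact: Rtr Rij (nonincrP uA (pincr _ _ ij)).
Qed.

Lemma wqo_nonincr A : wqo R A -> wqo (pointwise R) (nonincr R A).
Proof.
have [Rxx Rtr] := preR.
move=> wA0; move: (wA0); elim/(@wqo_residual_ind _ R): A / wA0 => A IH wA.
(* Such a sequence avoids the elements above [q] from the position [k] on, so
   it consists of [k] elements of [A] and a nonincreasing sequence in the
   residual of [q], to which the induction hypothesis applies. *)
have avoid q k : A q -> wqo (pointwise R) (nonincr R A `&` [set v | ~ R q (v k)]).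
  move=> Aq; set D := _ `&` _.
  have wlow m : wqo (fun v w => forall i, (i < m)%N -> R (v i) (w i)) D.
    elim: m => [|m IHm]; first by move=> v _; exists 0, 1.
    have wm : wqo (fun v w => R (v m) (w m)) D.
      by apply: (wqo_pullback (f := fun v => v m)) wA => // v [[vA _] _].
    apply: (wqo_pullback (f := id)) (wqo_conj _ IHm wm) => //.
      move=> v w _ _ [lo m_] i; rewrite ltnS leq_eqVlt => /predU1P[->//|].
      exact: lo.
    by move=> w v z vw wz i im; apply: Rtr (vw _ im) (wz _ im).
  have whigh : wqo (fun v w => forall i, R (v (k + i)%N) (w (k + i)%N)) D.
    have wq : wqo R (A `&` [set x | ~ R q x]).
      by apply: (wqo_pullback (f := id)) wA => // x [].
    apply: (wqo_pullback (f := fun v i => v (k + i)%N)) (IH q Aq wq) => //.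
    move=> v [vA nq]; have [vA1 vR] := vA; split=> n; last by rewrite addnS.
    split=> // qv; apply: nq; apply: Rtr qv _.
    exact: nonincrP vA (leq_addr _ _).
  apply: (wqo_pullback (f := id)) (wqo_conj _ (wlow k) whigh) => //.
    move=> v w _ _ [lo hi] i; case: (ltnP i k) => [/lo//|ki].
    by rewrite -(subnKC ki).
  by move=> w v z vw wz i im; apply: Rtr (vw _ im) (wz _ im).
move=> u uA.
have /choice[N NP] n := nonincr_stationary wA (uA n).
have [p pP] := wqo_increasing_subseq Rtr wA (fun n => (uA n).1 (N n)).
have u0_le_limit n k : (N (p 0) <= k)%N -> R (u (p 0) k) (u (p n.+1) (N (p n.+1))).
  by move=> Nk; apply: Rtr (nonincrP (uA _) Nk) _; have [] := pP 0 n.+1 isT.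
have limit_le n k : R (u n (N n)) (u n k).
  case: (leqP (N n) k) => [/NP//|/ltnW kN]; exact: nonincrP (uA n) kN.
(* By [u0_le_limit] and [limit_le], the first member of the subsequence fails
   to be below a later one only at a position before [N (p 0)]; hence, if there
   is no increasing pair, all later members lie in [D (N (p 0))]. *)
pose D m := nonincr R A `&`
  [set v | exists2 k, (k < m)%N & ~ R (u (p 0) k) (v k)].
have wD m : wqo (pointwise R) (D m).
  elim: m => [v vD|m IHm]; first by have [_ []] := vD 0.
  have wm := wqo_union IHm (avoid (u (p 0) m) m ((uA _).1 m)).
  apply: (wqo_pullback (f := id)) wm => // v [vA [k]].
  rewrite ltnS leq_eqVlt => /predU1P[->|km] nR; first by right.
  by left; split=> //; exists k.
apply: contrapT => bad.
have [n|i [j [ij Rij]]] := wD (N (p 0)) (fun n => u (p n.+1)); last first.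
  by apply: bad; exists (p i.+1), (p j.+1); split=> //; have [] := pP i.+1 j.+1 ij.
split=> //; apply: contrapT => nok; apply: bad; exists (p 0), (p n.+1).
split=> [|k]; first by have [] := pP 0 n.+1 isT.
case: (ltnP k (N (p 0))) => kN; last first.
  exact: Rtr (u0_le_limit n k kN) (limit_le _ _).
by apply: contrapT => nR; apply: nok; exists k.
Qed.

(** The values of a nonincreasing sequence up to the point where it becomes
    constant determine it. *)
Lemma coded_nonincr A : wqo R A -> coded R A ->
  coded (pointwise R) (nonincr R A).
Proof.
have [Rxx Rtr] := preR => wA [c cP].
have /choice[N NP] u : exists N, nonincr R A u ->
    forall k, (N <= k)%N -> R (u N) (u k).
  have [/(nonincr_stationary wA)[N NP]|] := pselect (nonincr R A u).
    by exists N.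
  by exists 0.
exists (fun u => pickle (mkseq (c \o u) (N u).+1)) => u v uA vA.
move=> /(pcan_inj pickleK) eq_uv.
have eqN : N u = N v by have /(congr1 size) := eq_uv; rewrite !size_mkseq => -[].
have low k : (k <= N u)%N -> R (u k) (v k).
  move=> kN; apply: cP; [exact: uA.1 | exact: vA.1 |].
  have /(congr1 (nth 0 ^~ k)) := eq_uv.
  by rewrite !nth_mkseq ?ltnS -?eqN.
move=> k; case: (leqP k (N u)) => [/low//|/ltnW Nk].
apply: (Rtr _ _ _ (nonincrP uA Nk)); apply: (Rtr _ _ _ (low _ (leqnn _))).
by rewrite eqN; apply: NP; rewrite -?eqN.
Qed.

End Nonincreasing.

(** * Antitone functions of the letter counts of a word *)

Section Words.
Context {d : Order.disp_t} {X : eqType} {Q : finPOrderType d}.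
Implicit Types (F G : seq X -> Q) (s v w : seq X) (x : X).

Definition antitone_sym : set (seq X -> Q) :=
  [set F | (forall v w, perm_eq v w -> F v = F w) /\
           (forall x v, F (x :: v) <= F v)].

Definition le_on s F G : Prop :=
  forall v, {subset v <= s} -> F v <= G v.

Lemma preorder_le_on s : preorder (le_on s).
Proof.
split=> [F v _ //|G F H FG GH v vs].
exact: le_trans (FG v vs) (GH v vs).
Qed.

(** The slices of [F] along the letter [x]; they express [F] over the alphabet
    [x :: s] as a sequence of functions over [s]. *)
Definition slice x F (k : nat) : seq X -> Q := fun v => F (nseq k x ++ v).

Lemma slice_nonincr x s F :
  antitone_sym F -> nonincr (le_on s) antitone_sym (slice x F).
Proof.
move=> [Fsym Fanti]; split=> [k|k v _]; last exact: Fanti.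
split=> [v w vw|y v]; first by apply: Fsym; rewrite perm_cat2l.
by rewrite /slice (Fsym _ (y :: (nseq k x ++ v))) // -cat_rcons -cats1 -catA perm_catCA.
Qed.

Lemma le_on_slice x s F G : antitone_sym F -> antitone_sym G ->
  pointwise (le_on s) (slice x F) (slice x G) -> le_on (x :: s) F G.
Proof.
move=> [Fsym _] [Gsym _] FG v vs.
have perm_v : perm_eq v (nseq (count_mem x v) x ++ filter (predC1 x) v).
  rewrite -(perm_filterC (pred1 x) v).
  suff -> : filter (pred1 x) v = nseq (count_mem x v) x by [].
  by elim: (v) => //= y w ->; case: eqVneq => [->|].
rewrite (Fsym _ _ perm_v) (Gsym _ _ perm_v); apply: FG => y.
by rewrite mem_filter => /andP[/= yx /vs]; rewrite inE (negPf yx).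
Qed.

Lemma le_on_nil F G : F [::] <= G [::] -> le_on [::] F G.
Proof. by move=> FG [|y v] // /(_ y (mem_head _ _)). Qed.

Lemma wqo_antitone_sym s : wqo (le_on s) antitone_sym.
Proof.
elim: s => [|x s IH].
  apply: (wqo_pullback (f := fun F => F [::]) (B := setT)
    (R' := fun a b : Q => a <= b)) => //; last exact: wqo_finite.
  by move=> F G _ _; exact: le_on_nil.
apply: wqo_pullback (wqo_nonincr (preorder_le_on s) IH).
  exact: slice_nonincr.
by move=> F G; exact: le_on_slice.
Qed.

Lemma coded_antitone_sym s : coded (le_on s) antitone_sym.
Proof.
elim: s => [|x s IH].
  exists (fun F => enum_rank (F [::]) : nat) => F G _ _ /val_inj/enum_rank_inj eqFG.
  by apply: le_on_nil; rewrite eqFG.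
apply: coded_pullback
  (coded_nonincr (preorder_le_on s) (wqo_antitone_sym s) IH).
  exact: slice_nonincr.
by move=> F G; exact: le_on_slice.
Qed.

End Words.

(** * Admissible operation sequences as functions of words *)

Section OpSeq.
Context {d : Order.disp_t} {L : finTBLatticeType d}.
Implicit Types (f g : opseq L) (v w : seq L).

(** The value at the empty word is [\top] so that adding a first letter also
    decreases the value. *)
Definition word_op f w : L :=
  if w is x :: v then f (size v) [ffun i : 'I_(size v).+1 => nth x w i] else \top.

Lemma word_opE f n w x0 : size w = n.+1 ->
  word_op f w = f n [ffun i : 'I_n.+1 => nth x0 w i].
Proof.
case: w => //= x v [<-]; congr (f _ _); apply/ffunP => i.
by rewrite !ffunE; apply: set_nth_default.
Qed.

Lemma word_op_antitone_sym f : admissible f -> antitone_sym (word_op f).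
Proof.
move=> [[_ _ f3] [f4 _ _]]; split=> [v w|x [|y v]]; first 1 last.
- exact: lex1.
- apply: le_trans (f3 _ _) _; rewrite le_eqVlt; apply/orP; left; apply/eqP.
  rewrite (@word_opE _ (size v) _ x) //; congr (f _ _).
  by apply/ffunP => i; rewrite !ffunE.
case: w => [/perm_nilP -> //|x w].
move=> vw; have /tuple_permP[p ->] : perm_eq v (cons_tuple x (in_tuple w)) by [].
rewrite (@word_opE _ (size w) _ x) ?size_tuple // (@word_opE _ (size w) _ x) //.
rewrite [RHS](f4 _ _ p); congr (f _ _); apply/ffunP => i.
by rewrite !ffunE -tnth_nth tnth_mktuple (tnth_nth x).
Qed.

Lemma opseq_le_word_op f g :
  le_on (enum L) (word_op f) (word_op g) -> opseq_le f g.
Proof.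
move=> fg n a; have size_a : size (mkseq (a \o inord) n.+1) = n.+1.
  exact: size_mkseq.
have := fg (mkseq (a \o inord) n.+1) (fun x _ => mem_enum _ x).
rewrite !(word_opE _ \bot size_a).
suff -> : [ffun i : 'I_n.+1 => nth \bot (mkseq (a \o inord) n.+1) i] = a by [].
by apply/ffunP => i; rewrite ffunE nth_mkseq //= inord_val.
Qed.

Lemma wqo_admissible : wqo opseq_le (admissible_opseqs L).
Proof.
apply: wqo_pullback (wqo_antitone_sym (enum L)).
  exact: word_op_antitone_sym.
by move=> f g _ _; exact: opseq_le_word_op.
Qed.

Lemma coded_admissible : coded opseq_le (admissible_opseqs L).
Proof.
apply: coded_pullback (coded_antitone_sym (enum L)).
  exact: word_op_antitone_sym.
by move=> f g _ _; exact: opseq_le_word_op.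
Qed.

End OpSeq.

Theorem theorem2p2 (d : Order.disp_t) (L : finTBLatticeType d) :
  countable (admissible_opseqs L) /\
  (~ exists u : nat -> opseq L,
       infinite_descending_chain opseq_le (admissible_opseqs L) u) /\
  (~ exists C : set (opseq L),
       infinite_antichain opseq_le (admissible_opseqs L) C).
Proof.
split; [|split].
- have [c cP] := @coded_admissible d L; apply/countable_injP; exists c.
  move=> f g; rewrite !inE => fA gA cfg.
  by apply: opseq_le_anti; apply: cP.
- move=> [u [uA udec]].
  have [i [j [ij uij]]] := wqo_admissible uA.
  have uanti : {homo u : m n / (m <= n)%N >-> opseq_le n m}.
    apply: (@homo_leq _ u (fun f g => opseq_le g f)) => [f|g f h fg gh|n].
    + exact: opseq_le_refl.
    + exact: opseq_le_trans gh fg.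
    + by have [] := udec n.
  have [ui_le] := udec i; apply; apply: opseq_le_anti => //.
  exact: opseq_le_trans uij (uanti _ _ ij).
- move=> [C [CA /infiniteP/card_leP[e] Canti]].
  pose u n : opseq L := val (e (to_setT n)).
  have Cu n : C (u n) := set_valP (e (to_setT n)).
  have [i [j [ij uij]]] := wqo_admissible (fun n => CA _ (Cu n)).
  have neq : u i <> u j.
    move=> /val_inj/inj; rewrite !inE => /(_ I I) /(congr1 val) /= eq_ij.
    by rewrite eq_ij ltnn in ij.
  by have [] := Canti _ _ (Cu i) (Cu j) neq.
Qed.
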